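(* Let $\Gamma$ be a connected regular graph with vertex set $V$, degree $k$, $n$ vertices, and spectrum $\{\theta_0^{1},\theta_1^{m_1},\theta_2^{m_2},\theta_3^{m_3}\}$ (exactly four distinct adjacency eigenvalues, exponents denoting multiplicities, $m_0=1$), where $\theta_0=k>\theta_1>\theta_2>\theta_3$, and let $\gamma_2$ be its preintersection number $$\gamma_2=\frac{\overline{\mathcal C}_{3}^2-\overline{\mathcal C}_{4}k+k^3}{k(\overline{\mathcal C}_{3}+k-k^2)},\qquad \overline{\mathcal C}_{\ell}=\frac1n\sum_{i=0}^3 m_i\theta_i^{\ell}.$$ Let $k_3(u)$ be the number of vertices at distance $3$ from $u$ in $\Gamma$, and let $\overline{k_3}=\frac{1}{n}\sum_{u\in V}k_3(u)$. Consider the polynomials $$s_1(x)=x^2-(\theta_1+\theta_3-\gamma_2)x+\gamma_2+\theta_2(\theta_1-\theta_2+\theta_3),$$ $$s_2(x)=x^2-(\theta_1+\theta_2-\gamma_2)x+\gamma_2+\theta_3(\theta_1-\theta_3+\theta_2).$$ Then, for $j=1,2$, $$\overline{k_3}\le \frac{n\sum_{i=1}^3 m_i(s_j(\theta_i)-\tau_j)^2}{\sum_{i=0}^3 m_i(s_j(\theta_i)-\tau_j)^2},\qquad\text{where}\quad \tau_j=\frac{s_j(\theta_0)\sum_{i=1}^3 m_i s_j(\theta_i)-\sum_{i=1}^3 m_i s_j(\theta_i)^2}{s_j(\theta_0)(n-1)-\sum_{i=1}^3 m_i s_j(\theta_i)}.$$ Moreover, equality holds in this inequality for some $j\in\{1,2\}$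 if and only if $\Gamma$ is a distance-regular graph and its distance-$2$ graph $\Gamma_2$ is strongly regular, with eigenvalues $$\lambda_0=n-\overline{k_3}-\theta_0-1,\quad \lambda_1=\frac{(\theta_1-\theta_2)(\theta_2-\theta_3)-\tau_1}{\gamma_2},\quad \lambda_2=-\frac{\tau_1}{\gamma_2},$$ or $$\lambda_0=n-\overline{k_3}-\theta_0-1,\quad \lambda_1=-\frac{\tau_2}{\gamma_2},\quad \lambda_2=\frac{(\theta_1-\theta_3)(\theta_3-\theta_2)-\tau_2}{\gamma_2},$$ where $\overline{k_3}=k_3$ is then the constant value of the number of vertices at distance $3$ from any vertex of $\Gamma$.
   Context: Graphs are finite, simple and undirected. The distance-$2$ graph $\Gamma_2$ has the same vertices as $\Gamma$, two vertices being adjacent if and only if they are at distance $2$ in $\Gamma$. A strongly regular graph is a regular graph, neither complete nor edgeless, in which the number of common neighbours of two distinct vertices depends only on whether they are adjacent or not; it is not required to be connected (e.g. a disjoint union of at least two complete graphs of the same size at least $2$ is strongly regular). Its eigenvalues are its valency $\lambda_0$ and the two distinct eigenvalues $\lambda_1>\lambda_2$ of its adjacency matrix on the orthogonal complement of the all-one vector. The number $\gamma_2$ is the constant such that the degree-$2$ predistance polynomial of $\Gamma$ is $p_2(x)=\frac1{\gamma_2}(x^2-\alpha_1x-k)$ with $\alpha_1=\overline{\mathcal C}_3/\overline{\mathcal C}_2$; it is given by the explicit formula in the statement. *)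

(* Defs.v *)
From mathcomp Require Import all_boot all_order all_algebra.
Set Implicit Arguments.
Unset Strict Implicit.
Unset Printing Implicit Defensive.
Import Order.TTheory GRing.Theory Num.Theory.
Local Open Scope ring_scope.

(* A simple graph on T is an edge relation e : rel T that is symmetric and
   irreflexive; these two properties are assumed where they are needed. *)
Section Graphs.
Variables (T : finType) (e : rel T).

Definition connected : Prop := forall u v : T, connect e u v.

Definition regular (k : nat) : Prop := forall u : T, #|[set v | e u v]| = k.

Definition walk (d : nat) (u v : T) : bool :=
  [exists p : d.-tuple T, path e u p && (last u p == v)].

Definition at_dist (d : nat) (u v : T) : bool :=
  walk d u v && [forall i : 'I_d, ~~ walk i u v].

Definition dist2_graph : rel T := at_dist 2.

Definition k3 (u : T) : nat := #|[set v | at_dist 3 u v]|.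

(* The number of neighbours of v at distance j from u depends only on j and on
   the distance i between u and v.  For j = i - 1, i, i + 1 these are the
   intersection numbers c_i, a_i, b_i; for the other j the count is 0. *)
Definition distance_regular : Prop :=
  connected /\
  forall (i j : nat) (u v u' v' : T), at_dist i u v -> at_dist i u' v' ->
    #|[set w | e v w & at_dist j u w]| = #|[set w | e v' w & at_dist j u' w]|.

Definition strongly_regular : Prop :=
  [/\ exists k : nat, regular k,
      exists u v : T, u != v /\ ~~ e u v,
      exists u v : T, e u v &
      exists lam mu : nat, forall u v : T, u != v ->
        #|[set w | e u w & e v w]| = if e u v then lam else mu].

End Graphs.

Section Spectra.
Variable R : rcfType.

Definition adjmx (T : finType) (e : rel T) : 'M[R]_#|T| :=
  \matrix_(i, j) (e (enum_val i) (enum_val j))%:R.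

Definition eigenvalue_orth1 (n : nat) (A : 'M[R]_n) (a : R) : Prop :=
  exists v : 'rV[R]_n, [/\ v != 0, \sum_(i < n) v 0 i = 0 & v *m A = a *: v].

Definition strongly_regular_with_eigenvalues (T : finType) (e : rel T)
    (l0 l1 l2 : R) : Prop :=
  [/\ strongly_regular e,
      exists2 d : nat, regular e d & l0 = d%:R,
      l2 < l1 &
      forall a : R, eigenvalue_orth1 (adjmx e) a <-> a = l1 \/ a = l2].

(* Of theta : nat -> R and m : nat -> nat only the values at 0, 1, 2, 3
   matter. *)
Definition has_spectrum4 (T : finType) (e : rel T) (theta : nat -> R)
    (m : nat -> nat) : Prop :=
  [/\ char_poly (adjmx e) = \prod_(0 <= i < 4) ('X - (theta i)%:P) ^+ m i,
      m 0%N = 1%N,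
      forall i : nat, (i < 4)%N -> (0 < m i)%N &
      [/\ theta 1%N < theta 0%N, theta 2%N < theta 1%N &
          theta 3%N < theta 2%N]].

Definition mean_k3 (T : finType) (e : rel T) : R :=
  #|T|%:R^-1 * \sum_(u : T) (k3 e u)%:R.

Section Bound.
Variables (n : nat) (theta : nat -> R) (m : nat -> nat).

Definition mean_moment (l : nat) : R :=
  n%:R^-1 * \sum_(0 <= i < 4) (m i)%:R * theta i ^+ l.

(* For a connected regular graph with four distinct eigenvalues (valency
   theta 0), the denominator is nonzero because the graph is not complete. *)
Definition gamma2 : R :=
  (mean_moment 3 ^+ 2 - mean_moment 4 * theta 0%N + theta 0%N ^+ 3) /
  (theta 0%N * (mean_moment 3 + theta 0%N - theta 0%N ^+ 2)).

Definition s1 : {poly R} :=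
  'X^2 - (theta 1%N + theta 3%N - gamma2) *: 'X
  + (gamma2 + theta 2%N * (theta 1%N - theta 2%N + theta 3%N))%:P.

Definition s2 : {poly R} :=
  'X^2 - (theta 1%N + theta 2%N - gamma2) *: 'X
  + (gamma2 + theta 3%N * (theta 1%N - theta 3%N + theta 2%N))%:P.

Definition tau (s : {poly R}) : R :=
  (s.[theta 0%N] * (\sum_(1 <= i < 4) (m i)%:R * s.[theta i])
   - \sum_(1 <= i < 4) (m i)%:R * s.[theta i] ^+ 2) /
  (s.[theta 0%N] * (n%:R - 1) - \sum_(1 <= i < 4) (m i)%:R * s.[theta i]).

Definition k3_bound (s : {poly R}) : R :=
  n%:R * (\sum_(1 <= i < 4) (m i)%:R * (s.[theta i] - tau s) ^+ 2) /
  (\sum_(0 <= i < 4) (m i)%:R * (s.[theta i] - tau s) ^+ 2).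

End Bound.
End Spectra.

(* Main.v *)
Require Import Defs.
From HB Require Import structures.
From mathcomp Require Import all_boot all_order all_algebra.
From mathcomp Require Import ring lra.
Import Order.TTheory GRing.Theory Num.Theory.
Local Open Scope ring_scope.
Set Implicit Arguments.
Unset Strict Implicit.
Unset Printing Implicit Defensive.

(* Let A, A2, A3 be the distance matrices and p = s_j - tau_j. As p has degree 2, the matrix
   p(A) vanishes at distance 3, so that <p(A), J - A3> is the sum n p(k) of all entries of
   p(A), and Cauchy-Schwarz gives (n p(k))^2 <= n (n - mean k3) tr p(A)^2, which is the bound
   (for an arbitrary value of tau_j). Equality means p(A) = c (J - A3), and J - A3 = I + A + A2
   because the Hoffman polynomial bounds the diameter by 3. Thus A2 is a quadratic polynomial
   in A; comparing traces gives c = gamma_2, the coefficient of A is the sum of two of the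
   theta_i, and A2 takes equal values on the corresponding two eigenspaces.
   Conversely, distance-regularity makes A2 a quadratic in A, and of the three eigenspaces two
   must share an eigenvalue of A2; the pair (theta_2, theta_3) is excluded by the vanishing of
   tr A, tr A2 and tr A A2, the others are told apart by the values of the eigenvalues. *)

(** * Polynomials evaluated at a square matrix of any size *)

Section EvalMx.
Variable R : comNzRingType.

(* [horner_mx] extended to matrices whose size is not syntactically a successor, such as [#|T|]. *)
Definition evalmx (n : nat) : 'M[R]_n -> {poly R} -> 'M[R]_n :=
  match n with 0 => fun A _ => A | n'.+1 => @horner_mx R n' end.

Fact evalmx_is_zmod_morphism n (A : 'M[R]_n) : zmod_morphism (evalmx A).
Proof.
case: n A => [|n] A p q /=; last exact: rmorphB.
by rewrite [LHS]flatmx0 [RHS]flatmx0.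
Qed.

Fact evalmx_is_monoid_morphism n (A : 'M[R]_n) : monoid_morphism (evalmx A).
Proof.
case: n A => [|n] A; first by split=> [|p q]; rewrite [LHS]flatmx0 [RHS]flatmx0.
by split=> [|p q] /=; rewrite (rmorph1, rmorphM).
Qed.

HB.instance Definition _ n (A : 'M[R]_n) :=
  GRing.isZmodMorphism.Build {poly R} 'M[R]_n (evalmx A)
    (evalmx_is_zmod_morphism A).
HB.instance Definition _ n (A : 'M[R]_n) :=
  GRing.isMonoidMorphism.Build {poly R} 'M[R]_n (evalmx A)
    (evalmx_is_monoid_morphism A).

Lemma evalmxX n (A : 'M[R]_n) : evalmx A 'X = A.
Proof. by case: n A => [|n] A //=; rewrite horner_mx_X. Qed.

Lemma evalmxC n (A : 'M[R]_n) a : evalmx A a%:P = a%:M.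
Proof.
by case: n A => [|n] A /=; [rewrite [LHS]flatmx0 [RHS]flatmx0 | rewrite horner_mx_C].
Qed.

Lemma evalmxZ n (A : 'M[R]_n) a p : evalmx A (a *: p) = a *: evalmx A p.
Proof.
by rewrite -mul_polyC rmorphM /= evalmxC -mul_scalar_mx.
Qed.

Lemma evalmxE n (A : 'M[R]_n) p :
  evalmx A p = \sum_(i < size p) p`_i *: A ^+ i.
Proof.
rewrite -{1}(coefK p) poly_def rmorph_sum /=; apply: eq_bigr => i _.
by rewrite evalmxZ rmorphXn /= evalmxX.
Qed.

Lemma trmx_exp n (A : 'M[R]_n) l : (A ^+ l)^T = A^T ^+ l.
Proof.
elim: l => [|l IHl]; first by rewrite !expr0 trmx1.
by rewrite exprS exprSr -IHl -[A * _]/(A *m _) trmx_mul.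
Qed.

Lemma trmx_evalmx n (A : 'M[R]_n) p : (evalmx A p)^T = evalmx A^T p.
Proof.
rewrite !evalmxE linear_sum /=; apply: eq_bigr => i _.
by rewrite linearZ /= trmx_exp.
Qed.

Lemma mulmx_evalmx n m (A : 'M[R]_n) (v : 'M_(m, n)) a p :
  v *m A = a *: v -> v *m evalmx A p = p.[a] *: v.
Proof.
move=> vA; rewrite evalmxE mulmx_sumr horner_coef scaler_suml.
apply: eq_bigr => i _; rewrite -scalemxAr -scalerA; congr (_ *: _).
elim: (nat_of_ord i) => [|l IHl]; first by rewrite !expr0 mulmx1 scale1r.
by rewrite exprSr -[_ * A]/(_ *m A) mulmxA IHl -scalemxAl vA scalerA -exprSr.
Qed.

Lemma cayley_hamilton_evalmx n (A : 'M[R]_n) : evalmx A (char_poly A) = 0.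
Proof.
case: n A => [|n] A; first by rewrite [LHS]flatmx0.
exact: Cayley_Hamilton.
Qed.

End EvalMx.

(** * Symmetric matrices with a split characteristic polynomial *)

Section Symmetric.
Variable R : realFieldType.

(** For symmetric [Z], the diagonal entries of [Z ^+ 2] are the sums of squares of the rows, so
    [Z ^+ 2 = 0] forces [Z = 0]. *)
Lemma symmx_nilpotent n (X : 'M[R]_n) l : X^T = X -> X ^+ l = 0 -> X = 0.
Proof.
move=> XT Xl; have sq (Z : 'M[R]_n) : Z^T = Z -> Z ^+ 2 = 0 -> Z = 0.
  move=> ZT Z2; apply/matrixP=> i j; rewrite mxE.
  have /eqP : (Z *m Z^T) i i = 0 by rewrite ZT -[Z *m Z]/(Z ^+ 2) Z2 mxE.
  rewrite mxE psumr_eq0 => [/allP/(_ j)|k _]; last by rewrite mxE -expr2 sqr_ge0.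
  by rewrite mem_index_enum mxE mulf_eq0 orbb => /(_ isT)/eqP.
(* The exponent is padded to a power of 2, which can then be halved repeatedly. *)
have {Xl}: X ^+ (2 ^ l) = 0.
  by rewrite -(subnK (ltnW (ltn_expl l (ltnSn 1)))) exprD Xl mulr0.
elim: l => [|l IHl]; first by rewrite expr1.
by rewrite expnSr exprM => /sq Xl; apply/IHl/Xl; rewrite trmx_exp XT.
Qed.

Variables (n : nat) (A : 'M[R]_n) (s : seq R).
Hypotheses (A_sym : A^T = A) (A_spec : char_poly A = \prod_(x <- s) ('X - x%:P)).

(** A power of the squarefree product is a multiple of the characteristic polynomial, so by
    Cayley-Hamilton its value at [A] is nilpotent; being symmetric, it is zero. *)
Lemma symmx_annihilator : evalmx A (\prod_(x <- undup s) ('X - x%:P)) = 0.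
Proof.
set P := \prod_(x <- _) _; apply: (@symmx_nilpotent _ _ (size s)).
  by rewrite trmx_evalmx A_sym.
rewrite -rmorphXn /=; suff /dvdpP[q ->]: char_poly A %| P ^+ size s.
  by rewrite rmorphM /= cayley_hamilton_evalmx mulr0.
rewrite A_spec.
(* Only this inclusion is kept, so that the induction on [s] can leave the squarefree product
   fixed. *)
have: {subset s <= undup s} by move=> x; rewrite mem_undup.
rewrite {}/P; move: (undup s) => t; elim: s => [|x r IHr] sub_t.
  by rewrite big_nil dvd1p.
rewrite big_cons exprS dvdp_mul //; last first.
  by apply: IHr => y ry; apply: sub_t; rewrite inE ry orbT.
by rewrite dvdp_XsubCl root_prod_XsubC sub_t ?mem_head.
Qed.

(** An annihilator with simple roots makes the matrix diagonalizable, and the characteristic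
    polynomial identifies the diagonal with [s] up to order. *)
Lemma mxtrace_evalmx p : \tr (evalmx A p) = \sum_(x <- s) p.[x].
Proof.
case: n A A_sym A_spec symmx_annihilator => [|n'] B B_sym B_spec B_ann.
  have /(congr1 (size : {poly R} -> nat)) := B_spec.
  rewrite size_char_poly size_prod_XsubC => -[/esym/size0nil->].
  by rewrite big_nil /mxtrace big_ord0.
have: diagonalizable B.
  apply/diagonalizableP; exists (undup s); first exact: undup_uniq.
  exact/mxminpoly_minP.
case=> P Pu /(diagonalizable_forLR Pu)[d Bd].
have Bp q : evalmx B q = invmx P *m diag_mx (map_mx (horner q) d) *m P.
  by rewrite /= Bd mxpoly.conjVmx // horner_mx_uconjC // horner_mx_diag.
have {B_spec}s_d : perm_eq s [seq d 0 i | i <- enum 'I_n'.+1].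
  apply: prod_XsubC_eq; rewrite -B_spec big_map enumT.
  rewrite Bd mxpoly.conjVmx // /char_poly.
  have -> : char_poly_mx (invmx P *m diag_mx d *m P) =
     map_mx polyC (invmx P) *m char_poly_mx (diag_mx d) *m map_mx polyC P.
    rewrite /char_poly_mx !map_mxM mulmxBr mulmxBl; congr (_ - _).
    by rewrite scalar_mxC -mulmxA -map_mxM mulVmx // map_mx1 mulmx1.
  rewrite !det_mulmx mulrC mulrA -det_mulmx -map_mxM mulmxV // map_mx1 det1 mul1r.
  rewrite -/(char_poly _) char_poly_trig ?diag_mx_is_trig //.
  by apply: eq_bigr => i _; rewrite mxE eqxx.
rewrite Bp mxtrace_mulC mulmxA mulmxV // mul1mx mxtrace_diag.
rewrite (perm_big _ s_d) big_map enumT.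
by apply: eq_bigr => i _; rewrite mxE.
Qed.
End Symmetric.

(** * Walks and distances *)

Section Walks.
Variables (T : finType) (e : rel T).

Lemma walk0 u v : walk e 0 u v = (u == v).
Proof.
apply/existsP/eqP => [[p]|->]; last by exists [tuple]; rewrite /= eqxx.
by rewrite tuple0 /= => /eqP.
Qed.

Lemma walkS l u v : walk e l.+1 u v = [exists w, e u w && walk e l w v].
Proof.
apply/existsP/existsP => [[p]|[w /andP[uw /existsP[p wv]]]]; last first.
  by exists [tuple of w :: p]; rewrite /= uw.
case/tupleP: p => w p /= /andP[/andP[uw wp] pv].
by exists w; rewrite uw; apply/existsP; exists p; rewrite wp.
Qed.

Lemma walk1 u v : walk e 1 u v = e u v.
Proof.
rewrite walkS; apply/existsP/idP => [[w]|uv].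
  by rewrite walk0 => /andP[uw /eqP<-].
by exists v; rewrite uv walk0 eqxx.
Qed.

Lemma at_dist_uniq i j u v : at_dist e i u v -> at_dist e j u v -> i = j.
Proof.
move=> /andP[wi /forallP ni] /andP[wj /forallP nj].
case: (ltngtP i j) => // lt; first by move: (nj (Ordinal lt)); rewrite wi.
by move: (ni (Ordinal lt)); rewrite wj.
Qed.

Lemma walk_at_dist l u v : walk e l u v -> exists2 i, (i <= l)%N & at_dist e i u v.
Proof.
move=> wl; have ex : exists l, walk e l u v by exists l.
case: (ex_minnP ex) => i wi min_i; exists i; first exact: min_i.
rewrite /at_dist wi; apply/forallP => j; apply: contraL (ltn_ord j) => /min_i.
by rewrite -leqNgt.
Qed.

Lemma at_dist0 u v : at_dist e 0 u v = (u == v).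
Proof.
by rewrite /at_dist walk0; case: eqP => //= _; apply/forallP => -[].
Qed.

Lemma dist2E u v :
  at_dist e 2 u v = [&& u != v, ~~ e u v & [exists w, e u w && e w v]].
Proof.
rewrite /at_dist walkS andbC.
have -> : [exists w, e u w && walk e 1 w v] = [exists w, e u w && e w v].
  by apply: eq_existsb => w; rewrite walk1.
rewrite andbA; congr (_ && _); apply/forallP/andP => [w2|[uv euv] [[|[|//]] lt]] /=.
- by split; [rewrite -walk0; apply: (w2 ord0) | rewrite -walk1; apply: (w2 (lift ord0 ord0))].
- by rewrite walk0.
- by rewrite walk1.
Qed.

Hypothesis e_irr : irreflexive e.

Lemma at_dist1 u v : at_dist e 1 u v = e u v.
Proof.
rewrite /at_dist walk1; case uv: (e u v) => //=.
apply/forallP => -[[|//] lt] /=; rewrite walk0.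
by apply: contraTneq uv => ->; rewrite e_irr.
Qed.

End Walks.

(** * Matrices indexed by vertices, and walks as entries of powers *)

Section VertexMatrices.
Variables (R : rcfType) (T : finType).
Implicit Types (M N : 'M[R]_#|T|) (r : rel T).

Definition entry M u v := M (enum_rank u) (enum_rank v).

Lemma entryP M N : (forall u v, entry M u v = entry N u v) -> M = N.
Proof.
by move=> MN; apply/matrixP => i j; have := MN (enum_val i) (enum_val j);
   rewrite /entry !enum_valK.
Qed.

Lemma entry_adj r u v : entry (adjmx R r) u v = (r u v)%:R.
Proof. by rewrite /entry mxE !enum_rankK. Qed.

Lemma sum_rank (F : 'I_#|T| -> R) : \sum_i F i = \sum_u F (enum_rank u).
Proof. by rewrite (reindex enum_rank) //; apply/onW_bij/enum_rank_bij. Qed.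

Lemma entryM M N u v :
  entry (M *m N) u v = \sum_w entry M u w * entry N w v.
Proof. by rewrite /entry mxE sum_rank. Qed.

Lemma entryD M N u v : entry (M + N) u v = entry M u v + entry N u v.
Proof. by rewrite /entry mxE. Qed.

Lemma entryN M u v : entry (- M) u v = - entry M u v.
Proof. by rewrite /entry mxE. Qed.

Lemma entryZ a M u v : entry (a *: M) u v = a * entry M u v.
Proof. by rewrite /entry mxE. Qed.

Lemma entry0 u v : entry 0 u v = 0.
Proof. by rewrite /entry mxE. Qed.

Lemma entry_scalar a u v : entry a%:M u v = a *+ (u == v).
Proof. by rewrite /entry mxE (inj_eq enum_rank_inj). Qed.

Lemma entry_const a u v : entry (const_mx a) u v = a.
Proof. by rewrite /entry mxE. Qed.

Definition entryE := (entryD, entryN, entryZ, entry0, entry_scalar, entry_const,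
  entry_adj).

Lemma mxtrace_entry M : \tr M = \sum_u entry M u u.
Proof. by rewrite /mxtrace sum_rank. Qed.

Lemma sum_rel (A : pred T) : \sum_u (A u)%:R = #|[set u | A u]|%:R :> R.
Proof. by rewrite -natr_sum -sum1dep_card -big_mkcond. Qed.

Lemma entry_adjM r1 r2 u v :
  entry (adjmx R r1 *m adjmx R r2) u v = #|[set w | r1 u w & r2 w v]|%:R.
Proof.
rewrite entryM -sum_rel; apply: eq_bigr => w _.
by rewrite !entry_adj -natrM mulnb.
Qed.

Lemma adjmx_sym r : symmetric r -> (adjmx R r)^T = adjmx R r.
Proof. by move=> r_sym; apply/matrixP => i j; rewrite !mxE r_sym. Qed.

Lemma adjmx_const r d :
  regular r d -> adjmx R r *m const_mx 1 = d%:R *: const_mx 1 :> 'cV_#|T|.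
Proof.
move=> r_reg; apply/matrixP => i j; rewrite !mxE -(r_reg (enum_val i)) -sum_rel.
rewrite sum_rank mulr1; apply: eq_bigr => u _.
by rewrite !mxE enum_rankK mulr1.
Qed.

Lemma entry_exp_walk r l u v : entry (adjmx R r ^+ l) u v != 0 -> walk r l u v.
Proof.
elim: l u => [|l IHl] u.
  by rewrite expr0 -[1]/(1%:M) entry_scalar walk0 mulrb; case: ifP => //; rewrite eqxx.
rewrite exprS -[_ * _]/(_ *m _) entryM walkS; apply: contraNT.
rewrite negb_exists => /forallP nw; apply/eqP/big1 => w _.
have := nw w; rewrite entry_adj; case: (r u w) => /=; last by rewrite mul0r.
by rewrite mul1r; apply: contraNeq => /IHl.
Qed.

Lemma entry_eval_walk r (p : {poly R}) u v :
  entry (evalmx (adjmx R r) p) u v != 0 -> exists2 l, (l < size p)%N & walk r l u v.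
Proof.
case: (boolP [exists l : 'I_(size p), walk r l u v]) => [/existsP[l wl]|].
  by exists (l : nat).
rewrite negb_exists => /forallP nw; case/eqP.
rewrite evalmxE /entry summxE big1 // => i _; rewrite mxE.
have := nw i; case: (eqVneq (entry (adjmx R r ^+ i) u v) 0) => [|/entry_exp_walk->//].
by rewrite /entry => ->; rewrite mulr0.
Qed.

(** Powers below the [d]-th only see walks shorter than [d], and none of these joins two vertices at
    distance [d]. *)
Lemma entry_eval_far r d (p : {poly R}) u v :
  (size p <= d)%N -> at_dist r d u v -> entry (evalmx (adjmx R r) p) u v = 0.
Proof.
move=> sz_p /andP[_ /forallP nw]; apply/eqP; apply: wlog_neg => /entry_eval_walk[l lt].
by have /negPf-> := nw (Ordinal (leq_trans lt sz_p)).
Qed.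

End VertexMatrices.

(** The [ti] stand for the eigenvalues of [A], and [q0], [q1], [q2], [q2] for those of [A2]. The
    second trace makes [q2] negative; subtracting [q2] times the first trace from the third then
    leaves a sum of nonnegative terms, not all zero. *)
Lemma trace_contradiction (R : realFieldType)
    (t0 t1 t2 t3 n1 n2 n3 q0 q1 q2 : R) :
  0 < n1 -> 0 < n2 -> 0 < n3 -> 0 < t0 -> 0 < t1 -> 0 <= q0 -> q2 < q1 ->
  t0 + n1 * t1 + n2 * t2 + n3 * t3 = 0 -> q0 + n1 * q1 + n2 * q2 + n3 * q2 = 0 ->
  t0 * q0 + n1 * (t1 * q1) + n2 * (t2 * q2) + n3 * (t3 * q2) = 0 -> False.
Proof.
move=> n1_gt0 n2_gt0 n3_gt0 t0_gt0 t1_gt0 q0_ge0 q21 trA trQ trAQ.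
have q2_lt0 : q2 < 0.
  rewrite ltNge; apply/negP => q2_ge0.
  have n1q1 : 0 < n1 * q1 by rewrite mulr_gt0 // (le_lt_trans q2_ge0).
  have n2q2 : 0 <= n2 * q2 by rewrite mulr_ge0 // ltW.
  have n3q2 : 0 <= n3 * q2 by rewrite mulr_ge0 // ltW.
  lra.
have eq0 : t0 * q0 - t0 * q2 + n1 * t1 * (q1 - q2) = 0.
  by rewrite -[RHS]trAQ -[LHS]addr0 -(mul0r q2) -trA; ring.
have t0q0 : 0 <= t0 * q0 by rewrite mulr_ge0 // ltW.
have t0q2 : t0 * q2 < 0 by rewrite pmulr_rlt0.
have n1t1 : 0 < n1 * t1 * (q1 - q2) by rewrite !mulr_gt0 // subr_gt0.
lra.
Qed.

(** * A monic quadratic with two values at three points *)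

Section Pigeonhole.
Variables (R : realFieldType) (x1 x2 x3 a b t : R).
Hypotheses (lt21 : x2 < x1) (lt32 : x3 < x2) (aN : a <> x2 + x3).
Local Notation Q x := (x ^+ 2 - a * x - b).

Let sumE x y z : x != y -> Q x = z -> Q y = z -> a = x + y.
Proof.
rewrite -subr_eq0 => xy Qx Qy; have : (x - y) * (x + y - a) = 0.
  by rewrite -[RHS](subrr z) -{1}Qx -Qy; ring.
by move/eqP; rewrite mulf_eq0 (negPf xy) subr_eq0 => /eqP.
Qed.

Let lt31 : x3 < x1 := lt_trans lt32 lt21.
Let u := (x1 - x2) * (x2 - x3).
Let w := (x1 - x3) * (x2 - x3).
Let u_gt0 : 0 < u. Proof. by rewrite mulr_gt0 ?subr_gt0. Qed.
Let lt_uw : u < w. Proof. by rewrite ltr_pM2r ?subr_gt0 // ltrD2l ltrN2. Qed.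

(** Two of the three points share a value, and by [sumE] their sum is [a]; the pair [x2], [x3] is
    ruled out by [aN]. The four cases record which other pair it is and which of the two values it
    takes; the gap to the value at the third point is then [u] or [w] in absolute value. *)
Let two_values d : (forall x, x \in [:: x1; x2; x3] -> Q x = d - t \/ Q x = - t) ->
  [\/ [/\ a = x1 + x2, Q x3 = - t & w = - d],
      [/\ a = x1 + x2, Q x3 = d - t & w = d],
      [/\ a = x1 + x3, Q x2 = - t & u = d]
    | [/\ a = x1 + x3, Q x2 = d - t & u = - d]].
Proof.
move=> Qx; have /Qx Q1 : x1 \in [:: x1; x2; x3] by rewrite !inE eqxx.
have /Qx Q2 : x2 \in [:: x1; x2; x3] by rewrite !inE eqxx orbT.
have /Qx Q3 : x3 \in [:: x1; x2; x3] by rewrite !inE eqxx !orbT.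
have wE : a = x1 + x2 -> w = Q x3 - Q x1 by rewrite /w => ->; ring.
have uE : a = x1 + x3 -> u = Q x1 - Q x2 by rewrite /u => ->; ring.
have [n12 n13 n23] : [/\ x1 != x2, x1 != x3 & x2 != x3] by rewrite !gt_eqF.
case: Q2 Q3 Q1 => Q2 [] Q3 [] Q1; try by case: aN; apply: sumE n23 Q2 Q3.
- have aE := sumE n12 Q1 Q2; constructor 1; split=> //.
  by rewrite (wE aE) Q1 Q3; ring.
- have aE := sumE n13 Q1 Q3; constructor 4; split=> //.
  by rewrite (uE aE) Q1 Q2; ring.
- have aE := sumE n13 Q1 Q3; constructor 3; split=> //.
  by rewrite (uE aE) Q1 Q2; ring.
- have aE := sumE n12 Q1 Q2; constructor 2; split=> //.
  by rewrite (wE aE) Q1 Q3; ring.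
Qed.

(** Here [d = u], and [d = - w] in [quad_two_values12]; as [0 < u < w], each choice is compatible
    with exactly one of the four cases. *)
Lemma quad_two_values13 :
  (forall x, x \in [:: x1; x2; x3] -> Q x = (x1 - x2) * (x2 - x3) - t \/ Q x = - t) ->
  a = x1 + x3 /\ b = t - x2 * (x1 - x2 + x3).
Proof.
rewrite -/u => /two_values[] [aE Qx E]; try by move: u_gt0 lt_uw; lra.
by split=> //; rewrite -[t]opprK -Qx aE; ring.
Qed.

Lemma quad_two_values12 :
  (forall x, x \in [:: x1; x2; x3] -> Q x = (x1 - x3) * (x3 - x2) - t \/ Q x = - t) ->
  a = x1 + x2 /\ b = t - x3 * (x1 - x3 + x2).
Proof.
have -> : (x1 - x3) * (x3 - x2) = - w by rewrite /w; ring.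
move=> /two_values[] [aE Qx E]; try by move: u_gt0 lt_uw; lra.
by split=> //; rewrite -[t]opprK -Qx aE; ring.
Qed.

End Pigeonhole.

(** * Traces and independence for a spectrum of four eigenvalues *)

Section FourEigenvalues.
Variables (R : rcfType) (T : finType) (e : rel T) (k : nat).
Variables (theta : nat -> R) (m : nat -> nat).
Hypotheses (e_sym : symmetric e) (e_irr : irreflexive e).
Hypotheses (e_conn : connected e) (e_reg : regular e k).
Hypotheses (theta0 : theta 0%N = k%:R) (spec : has_spectrum4 e theta m).

Local Notation A := (adjmx R e).
Local Notation A2 := (adjmx R (at_dist e 2)).
Local Notation A3 := (adjmx R (at_dist e 3)).
Local Notation J := (const_mx 1 : 'M[R]_#|T|).
Local Notation n := (#|T|%:R : R).
Local Notation kbar := (mean_k3 R e).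
Local Notation ev := (evalmx A).
Local Notation wsum p := (\sum_(0 <= i < 4) (m i)%:R * p.[theta i]).

Let s := flatten [seq nseq (m i) (theta i) | i <- iota 0 4].

Let A_sym : A^T = A. Proof. exact: adjmx_sym. Qed.

Let A_spec : char_poly A = \prod_(x <- s) ('X - x%:P).
Proof.
case: spec => -> _ _ _; rewrite big_flatten big_map; apply: eq_bigr => i _.
by rewrite big_nseq; elim: (m i) => [|l IHl] //=; rewrite exprS IHl.
Qed.

Lemma theta_uniq : uniq [seq theta i | i <- iota 0 4].
Proof.
case: spec => _ _ _ [lt01 lt12 lt23].
have lt02 := lt_trans lt12 lt01; have lt13 := lt_trans lt23 lt12.
have lt03 := lt_trans lt13 lt01.
by rewrite /= !inE !negb_or !gt_eqF.
Qed.

Lemma trace_eval p : \tr (ev p) = wsum p.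
Proof.
rewrite (mxtrace_evalmx A_sym A_spec) big_flatten big_map.
apply: eq_bigr => i _; rewrite big_nseq.
by elim: (m i) => [|l IHl]; rewrite ?mul0r //= IHl mulrS mulrDl mul1r.
Qed.

Lemma eval_annihilator : ev (\prod_(0 <= i < 4) ('X - (theta i)%:P)) = 0.
Proof.
rewrite -(symmx_annihilator A_sym A_spec) -(big_map theta xpredT (fun x => 'X - x%:P)).
congr (ev _); apply: perm_big; apply: uniq_perm => [||x].
- exact: theta_uniq.
- exact: undup_uniq.
rewrite mem_undup; apply/mapP/flatten_mapP => -[i i4].
  move=> ->; exists i => //; rewrite mem_nseq eqxx andbT.
  by case: spec => _ _ m_gt0 _; apply: m_gt0; move: i4; rewrite mem_iota.
by rewrite mem_nseq => /andP[_ /eqP->]; exists i.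
Qed.

Lemma nb_vertices_gt0 : 0 < n.
Proof.
have := trace_eval 1; rewrite rmorph1 mxtrace1 => ->.
case: spec => _ m0 _ _; rewrite big_ltn // m0 !hornerE.
by rewrite ltr_pwDl // sumr_ge0 // => i _; rewrite !hornerE.
Qed.

(** A nonzero polynomial of degree at most 3 cannot vanish at all four distinct [theta i], and all
    multiplicities are positive. *)
Lemma wsum_sqr_gt0 (p : {poly R}) :
  p != 0 -> (size p <= 4)%N -> 0 < \sum_(0 <= i < 4) (m i)%:R * p.[theta i] ^+ 2.
Proof.
move=> p0 sz; have term_ge0 i : 0 <= (m i)%:R * p.[theta i] ^+ 2.
  by rewrite mulr_ge0 ?sqr_ge0.
rewrite lt_neqAle sumr_ge0 ?andbT // eq_sym; apply: contraNneq p0 => w0.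
apply/eqP/(roots_geq_poly_eq0 (rs := [seq theta i | i <- iota 0 4])) => //.
  apply/allP => _ /mapP[i i4 ->]; apply/rootP.
  have /eqP := w0; rewrite psumr_eq0 // => /allP/(_ i i4) /=.
  case: spec => _ _ m_gt0 _; move: i4; rewrite mem_iota /= => /m_gt0 mi.
  by rewrite mulf_eq0 pnatr_eq0 eqn0Ngt mi /= sqrf_eq0 => /eqP.
exact: theta_uniq.
Qed.

(** Otherwise the trace of [ev (p * p)], which is the positive weighted sum of squares, would
    vanish. *)
Lemma eval_neq0 (p : {poly R}) : p != 0 -> (size p <= 4)%N -> ev p != 0.
Proof.
move=> p0 sz; have := wsum_sqr_gt0 p0 sz; apply: contraTneq => p_0.
suff -> : \sum_(0 <= i < 4) (m i)%:R * p.[theta i] ^+ 2 = 0 by rewrite ltxx.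
have : \tr (ev (p * p)) = 0 by rewrite rmorphM /= p_0 mul0r mxtrace0.
by rewrite trace_eval; apply: etrans; apply: eq_bigr => i _; rewrite hornerM.
Qed.

Let row_const : const_mx 1 *m A = theta 0%N *: const_mx 1 :> 'rV_#|T|.
Proof.
by apply: trmx_inj; rewrite trmx_mul A_sym !linearZ /= !trmx_const theta0 (adjmx_const _ e_reg).
Qed.

Lemma colsum_eval p v : \sum_u entry (ev p) u v = p.[theta 0%N].
Proof.
have /matrixP/(_ 0 (enum_rank v)) := mulmx_evalmx p row_const.
rewrite !mxE mulr1 sum_rank => <-; apply: eq_bigr => u _.
by rewrite mxE mul1r.
Qed.

Lemma entry_eval_sym p u v : entry (ev p) u v = entry (ev p) v u.
Proof. by rewrite /entry -{1}[ev p]trmxK trmx_evalmx A_sym mxE. Qed.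

(** * The bound on the mean of [k3] by Cauchy-Schwarz *)

Section Bound.
Variable p : {poly R}.
Hypotheses (p_neq0 : p != 0) (size_p : (size p <= 3)%N).

Local Notation w := (\sum_(0 <= i < 4) (m i)%:R * p.[theta i] ^+ 2).
Local Notation bound :=
  (n * (\sum_(1 <= i < 4) (m i)%:R * p.[theta i] ^+ 2) / w).

(** The mean number of vertices not at distance 3 from a vertex; thus [n * r] is the squared
    Frobenius norm of [J - A3]. *)
Let r := n - kbar.

Let sumM : \sum_u \sum_v (1 - (at_dist e 3 u v)%:R) = n * r.
Proof.
rewrite /r mulrBr mulVKf ?gt_eqF ?nb_vertices_gt0 // -[in RHS]sumr_const.
rewrite [in RHS]mulr_suml -sumrB; apply: eq_bigr => u _.
by rewrite sumrB sum_rel mul1r sumr_const.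
Qed.

Let r_gt0 : 0 < r.
Proof.
rewrite -(pmulr_rgt0 _ nb_vertices_gt0) -sumM; apply: (@lt_le_trans _ _ n).
  exact: nb_vertices_gt0.
rewrite -sumr_const; apply: ler_sum => u _; rewrite (bigD1 u) //=.
have /negPf-> : ~~ at_dist e 3 u u.
  by apply/negP=> /(@at_dist_uniq _ _ 3 0); rewrite at_dist0 eqxx => /(_ isT).
rewrite subr0 lerDl sumr_ge0 // => v _.
by case: at_dist; rewrite ?subrr ?subr0.
Qed.

(** The squared norm of [ev p] is the trace of its square, by symmetry. Its inner product with
    [J - A3] is the sum of all its entries, because [p] has degree at most 2 and [ev p] therefore
    vanishes at distance 3. *)
Let dev c : \sum_u \sum_v entry (ev p - c *: (J - A3)) u v ^+ 2 =
  w - 2 * c * (n * p.[theta 0%N]) + c ^+ 2 * (n * r).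
Proof.
have -> : w = \sum_u \sum_v entry (ev p) u v ^+ 2.
  rewrite (eq_bigr (fun i => (m i)%:R * (p * p).[theta i])); last first.
    by move=> i _; rewrite hornerM.
  rewrite -trace_eval rmorphM mxtrace_entry; apply: eq_bigr => u _.
  rewrite -[_ * _]/(_ *m _) entryM; apply: eq_bigr => v _.
  by rewrite (entry_eval_sym _ v).
have -> : n * p.[theta 0%N] = \sum_u \sum_v entry (ev p) u v.
  rewrite exchange_big /= (eq_bigr _ (fun v _ => colsum_eval p v)).
  by rewrite sumr_const mulr_natl.
rewrite -sumM !mulr_sumr -sumrB -big_split; apply: eq_bigr => u _ /=.
rewrite !mulr_sumr -sumrB -big_split; apply: eq_bigr => v _ /=.
rewrite !entryE; case d3: (at_dist e 3 u v); last by rewrite /=; ring.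
by rewrite (entry_eval_far size_p d3) /=; ring.
Qed.

(** This [c] minimizes the quadratic of [dev]; nonnegativity of the minimum is the Cauchy-Schwarz
    inequality. *)
Let dev_min : \sum_u \sum_v entry (ev p - (p.[theta 0%N] / r) *: (J - A3)) u v ^+ 2
  = w - n * p.[theta 0%N] ^+ 2 / r.
Proof. by rewrite dev; field; rewrite gt_eqF. Qed.

Let w_gt0 : 0 < w. Proof. by apply: wsum_sqr_gt0 => //; apply: leqW. Qed.

(** The gap between bound and mean is the Cauchy-Schwarz deficit divided by [w]; the term of index 0
    is split off using [m 0 = 1]. *)
Let boundE : bound = kbar + (r * w - n * p.[theta 0%N] ^+ 2) / w.
Proof.
have -> : \sum_(1 <= i < 4) (m i)%:R * p.[theta i] ^+ 2 = w - p.[theta 0%N] ^+ 2.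
  rewrite [w]big_ltn //; case: spec => _ -> _ _; rewrite mul1r.
  by rewrite [RHS]addrAC subrr add0r.
by rewrite /r; field; rewrite gt_eqF.
Qed.

Lemma mean_k3_le_bound : kbar <= bound.
Proof.
rewrite boundE lerDl divr_ge0 ?(ltW w_gt0) //.
have : 0 <= w - n * p.[theta 0%N] ^+ 2 / r.
  by rewrite -dev_min; do 2![apply: sumr_ge0 => ? _]; apply: sqr_ge0.
by rewrite !subr_ge0 ler_pdivrMr // (mulrC r).
Qed.

Lemma mean_k3_eq_bound :
  kbar = bound <-> exists c, ev p = c *: (J - A3).
Proof.
have eqB : kbar = bound <-> w - n * p.[theta 0%N] ^+ 2 / r = 0.
  have w0 : w != 0 by rewrite gt_eqF.
  have r0 : r != 0 by rewrite gt_eqF.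
  rewrite boundE; split=> [/eqP|/eqP].
    rewrite -{1}[kbar]addr0 (inj_eq (addrI _)) eq_sym mulf_eq0 invr_eq0 (negPf w0) orbF.
    by rewrite subr_eq0 => /eqP rw; rewrite -rw; field.
  rewrite subr_eq0 => /eqP wE; suff -> : r * w = n * p.[theta 0%N] ^+ 2.
    by rewrite subrr mul0r addr0.
  by rewrite {1}wE; field.
apply: (iff_trans eqB); split=> [|[c pA]].
  rewrite -dev_min => /eqP dev0; exists (p.[theta 0%N] / r); apply/entryP => u v.
  move: dev0; rewrite psumr_eq0; last by move=> x _; apply: sumr_ge0 => y _; apply: sqr_ge0.
  move=> /allP/(_ u); rewrite mem_index_enum => /(_ isT) /=.
  rewrite psumr_eq0; last by move=> y _; apply: sqr_ge0.
  move=> /allP/(_ v); rewrite mem_index_enum => /(_ isT) /=.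
  by rewrite sqrf_eq0 entryD entryN subr_eq0 => /eqP.
(* Comparing the sums of all entries on both sides shows that [c] can only be the minimizer. *)
have cE : c = p.[theta 0%N] / r.
  apply: (canRL (mulfK _)); rewrite ?gt_eqF //; apply: (mulfI (lt0r_neq0 nb_vertices_gt0)).
  rewrite mulrCA -sumM mulr_sumr.
  rewrite mulr_natl -sumr_const -(eq_bigr _ (fun v _ => colsum_eval p v)).
  rewrite exchange_big; apply: eq_bigr => u _ /=; rewrite mulr_sumr.
  by apply: eq_bigr => v _; rewrite pA !entryE.
rewrite -dev_min -cE -pA subrr; apply: big1 => u _; apply: big1 => v _.
by rewrite entry0 expr0n.
Qed.

End Bound.

(** * The Hoffman polynomial and the diameter *)

Lemma harmonic_const (f : T -> R) :
  (forall u, \sum_(w | e u w) f w = k%:R * f u) -> forall u v, f u = f v.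
Proof.
(* Maximum principle: where [f] is maximal, its mean over the neighbours is the maximum, so every
   neighbour attains it; connectedness spreads this to all vertices. *)
move=> f_harm x y; case: (@arg_maxP _ _ T x xpredT f isT) => u0 _ f_max.
suff f_u0 v : f v = f u0 by rewrite !f_u0.
have /connectP[q] := e_conn u0 v; elim/last_ind: q v => [|q w IHq] v; first by move=> _ ->.
rewrite rcons_path last_rcons => /andP[/IHq/(_ erefl)]; set u := last _ _.
move=> fu uw ->; have : \sum_(w' | e u w') (f u0 - f w') = 0.
  rewrite sumrB f_harm fu sumr_const -(e_reg u) mulr_natl.
  by rewrite (eq_card (B := [set w' | e u w'])) ?subrr // => ?; rewrite inE.
move/eqP; rewrite psumr_eq0 => [/allP/(_ w)|w' _]; last by rewrite subr_ge0; apply: f_max.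
by rewrite mem_index_enum uw subr_eq0 => /(_ isT)/eqP.
Qed.

Lemma vertex_exists : exists x : T, true.
Proof. by have /[!ltr0n]/card_gt0P[x _] := nb_vertices_gt0; exists x. Qed.

Local Notation cubic := (\prod_(1 <= i < 4) ('X - (theta i)%:P)).

(* The Hoffman polynomial of the graph, up to normalization. *)
Lemma eval_cubic : exists2 y, y != 0 & ev cubic = y *: J.
Proof.
have [x _] := vertex_exists; have cubic_sz : size cubic = 4%N.
  by rewrite size_prod_XsubC size_iota.
(* Multiplying [cubic] by the missing factor gives the annihilator, so the columns of [ev cubic] are
   harmonic. *)
have AY : A *m ev cubic = theta 0%N *: ev cubic.
  apply/eqP; rewrite -subr_eq0 -mul_scalar_mx -mulmxBl.
  have := eval_annihilator; rewrite big_ltn // rmorphM rmorphB /= evalmxX evalmxC.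
  by move=> <-.
have col_const v u u' : entry (ev cubic) u v = entry (ev cubic) u' v.
  apply: (harmonic_const (f := fun u => entry (ev cubic) u v)) => {}u.
  rewrite -theta0 -entryZ -AY entryM big_mkcond; apply: eq_bigr => w _.
  by rewrite entry_adj; case: (e u w); rewrite ?mul1r ?mul0r.
exists (entry (ev cubic) x x); last first.
  apply/entryP => u v; rewrite !entryE mulr1 (col_const v u x).
  by rewrite entry_eval_sym; apply: col_const.
have /eval_neq0 : cubic != 0 by rewrite -size_poly_eq0 cubic_sz.
rewrite cubic_sz => /(_ isT); apply: contraNneq => Y0; apply/eqP/entryP => u v.
by rewrite entry0 (col_const v u x) entry_eval_sym (col_const x v x).
Qed.

(** Every entry of [ev cubic] is nonzero and [cubic] has degree 3, so any two vertices are joined by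
    a walk of length at most 3. *)
Lemma diameter_le3 u v : exists2 i, (i <= 3)%N & at_dist e i u v.
Proof.
have [y y0 Y] := eval_cubic.
have /entry_eval_walk[l] : entry (ev cubic) u v != 0 by rewrite Y !entryE mulr1.
rewrite size_prod_XsubC size_iota => l4 /walk_at_dist[i il id].
by exists i => //; apply: leq_trans il l4.
Qed.

Lemma distance_sum : J - A3 = 1%:M + A + A2.
Proof.
apply/entryP => u v; rewrite !entryE.
have [i i3 uv] := diameter_le3 u v.
have uniq j : at_dist e j u v = (j == i).
  by apply/idP/eqP => [/at_dist_uniq/(_ uv) | ->].
rewrite -(at_dist0 e) -(at_dist1 e_irr) !uniq.
by case: i i3 {uv uniq} => [|[|[|[|]]]] //= _; rewrite ?mulr0n ?mulr1n; ring.
Qed.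

Lemma dist2_sym : symmetric (at_dist e 2).
Proof.
move=> u v; rewrite !dist2E eq_sym e_sym; congr [&& _, _ & _].
by apply: eq_existsb => w; rewrite andbC !(e_sym w).
Qed.

Lemma sum4 (F : nat -> R) : \sum_(0 <= i < 4) F i = F 0%N + F 1%N + F 2%N + F 3%N.
Proof. by rewrite unlock /= addr0 !addrA. Qed.

Definition quad (a b : R) : {poly R} := 'X^2 - a *: 'X - b%:P.

Lemma horner_quad a b x : (quad a b).[x] = x ^+ 2 - a * x - b.
Proof. by rewrite !hornerE. Qed.

Lemma size_quad a b : size (quad a b) = 3%N.
Proof.
rewrite /quad -addrA size_polyDl size_polyXn // -opprD size_polyN.
apply: leq_ltn_trans (size_polyD _ _) _; rewrite gtn_max.
by rewrite (leq_ltn_trans (size_scale_leq _ _)) ?size_polyX // (leq_ltn_trans (size_polyC_leq1 _)).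
Qed.

Lemma quad_neq0 a b : quad a b != 0.
Proof. by rewrite -size_poly_eq0 size_quad. Qed.

Lemma ev_quad a b : ev (quad a b) = A *m A - a *: A - b%:M.
Proof. by rewrite !rmorphB /= rmorphXn /= evalmxZ evalmxX evalmxC. Qed.

Let AA_diag u : entry (A *m A) u u = theta 0%N.
Proof.
rewrite entry_adjM theta0 -(e_reg u); congr _%:R; apply: eq_card => w.
by rewrite !inE e_sym andbb.
Qed.

Let trA : wsum ('X : {poly R}) = 0.
Proof. by rewrite -trace_eval evalmxX mxtrace_entry big1 // => u _; rewrite entry_adj e_irr. Qed.

(** * Graphs whose distance-2 matrix is quadratic in [A] *)

Section QuadraticDist2.
Variables (a b c : R).
Hypotheses (c_neq0 : c != 0) (quadA2 : ev (quad a b) = c *: A2).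

Lemma quad_const : b = theta 0%N.
Proof.
have [x _] := vertex_exists.
have := congr1 (fun M => entry M x x) quadA2.
rewrite ev_quad !entryE AA_diag e_irr dist2E eqxx mulr1n !mulr0 subr0 => /eqP.
by rewrite subr_eq0 => /eqP.
Qed.

Lemma wsum_quad : wsum (quad a b) = 0.
Proof.
rewrite -trace_eval quadA2 mxtraceZ mxtrace_entry big1 ?mulr0 // => u _.
by rewrite entry_adj dist2E eqxx.
Qed.

Lemma wsum_Xquad : wsum ('X * quad a b) = 0.
Proof.
rewrite -trace_eval rmorphM /= evalmxX quadA2 -[_ * _]/(_ *m _) -scalemxAr mxtraceZ.
rewrite mxtrace_entry big1 ?mulr0 // => u _; rewrite entryM big1 // => v _.
rewrite !entry_adj dist2E (e_sym v).
by case: (e u v); rewrite ?mul0r // andbF mulr0.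
Qed.

Lemma quad_row v : (quad a b).[theta 0%N] = c * #|[set u | at_dist e 2 v u]|%:R.
Proof.
rewrite -(colsum_eval _ v) -sum_rel mulr_sumr; apply: eq_bigr => u _.
by rewrite quadA2 entryZ entry_adj dist2_sym.
Qed.

(** If this multiple of the row sums of [A2] were zero, [A2] would vanish, although a nonzero
    polynomial of degree 2 does not annihilate [A]. *)
Lemma quad_theta0_neq0 : (quad a b).[theta 0%N] != 0.
Proof.
have := eval_neq0 (quad_neq0 a b); rewrite size_quad quadA2 => /(_ isT).
apply: contraNneq => Q0; rewrite scaler_eq0 (negPf c_neq0); apply/eqP/entryP => u v.
have /eqP := quad_row u; rewrite Q0 eq_sym mulf_eq0 (negPf c_neq0) pnatr_eq0 cards_eq0.
by move=> /eqP/setP/(_ v); rewrite !inE entryE entry0 => ->.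
Qed.

Lemma exists_dist2 : exists u v, at_dist e 2 u v.
Proof.
have [x _] := vertex_exists; have := quad_theta0_neq0; rewrite (quad_row x).
rewrite mulf_eq0 negb_or pnatr_eq0 cards_eq0 => /andP[_ /set0Pn[v]].
by rewrite inE; exists x, v.
Qed.

(** The traces of [1], [A], [A2], [A A2] and [A2 ^+ 2] determine the moments up to the fourth in
    terms of [a], [c] and [theta 0]; the formula for [gamma2] then simplifies to [c]. *)
Lemma gamma2_quad : gamma2 #|T| theta m = c.
Proof.
(* As [A2] has entries 0 and 1, squaring an entry of [c *: A2] amounts to multiplying it by [c]. *)
have W2 : wsum (quad a b * quad a b) = c * (n * (quad a b).[theta 0%N]).
  rewrite -trace_eval rmorphM mxtrace_entry /= {2}quadA2.
  rewrite -[_ * _]/(_ *m _) -scalemxAr.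
  rewrite mulr_natl -sumr_const mulr_sumr; apply: eq_bigr => u _.
  rewrite entryZ -(colsum_eval _ u) entryM; congr (_ * _); apply: eq_bigr => v _.
  rewrite (entry_eval_sym _ v) quadA2 !entryE (dist2_sym v).
  by case: at_dist; rewrite ?(mulr0, mulr1).
have W0 : wsum (1 : {poly R}) = n by rewrite -trace_eval rmorph1 mxtrace1.
have bE := quad_const; have nz := quad_theta0_neq0.

pose M l := \sum_(0 <= i < 4) (m i)%:R * theta i ^+ l.
have M4 l : M l = (m 0%N)%:R * theta 0%N ^+ l + (m 1%N)%:R * theta 1%N ^+ l
   + (m 2%N)%:R * theta 2%N ^+ l + (m 3%N)%:R * theta 3%N ^+ l.
  by rewrite /M sum4.
have M0 : M 0%N = n.
  by rewrite -W0; apply: eq_bigr => i _; rewrite !hornerE.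
have M1 : M 1%N = 0.
  by rewrite -trA; apply: eq_bigr => i _; rewrite hornerX.
have M2 : M 2%N = theta 0%N * n.
  have -> : M 2%N = theta 0%N * M 0%N + wsum (quad a b) + a * M 1%N.
    by rewrite !M4 !sum4 !horner_quad bE; ring.
  by rewrite M0 M1 wsum_quad mulr0 !addr0.
have M3 : M 3%N = a * theta 0%N * n.
  have -> : M 3%N = a * M 2%N + wsum ('X * quad a b) + b * M 1%N.
    by rewrite !M4 !sum4 !hornerM !hornerX !horner_quad; ring.
  by rewrite M1 M2 wsum_Xquad mulr0 !addr0 mulrA.
have {W2} : M 4%N - 2 * a * M 3%N + (a ^+ 2 - 2 * b) * M 2%N + 2 * a * b * M 1%N
    + b ^+ 2 * M 0%N = c * (n * (quad a b).[theta 0%N]).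
  by rewrite -W2 !M4 !sum4 !hornerM !horner_quad; ring.
rewrite M0 M1 M2 M3 horner_quad bE => M4E; rewrite horner_quad bE in nz.
have {}M4E : M 4%N = n * (a ^+ 2 * theta 0%N + theta 0%N ^+ 2
    + c * (theta 0%N ^+ 2 - a * theta 0%N - theta 0%N)).
  by apply: (addIr (- (n * (a ^+ 2 * theta 0%N + theta 0%N ^+ 2)))); rewrite -[LHS]addr0; lra.
rewrite /gamma2 /mean_moment -!/(M _) M3 M4E; field.
(* The other factors of the denominator, [theta 0] and the bracket, can vanish only if [quad a b]
   vanishes at [theta 0]. *)
rewrite (lt0r_neq0 nb_vertices_gt0) /=; apply/andP; split; apply: contraNneq nz => E.
  by rewrite -oppr_eq0 -[X in _ == X]E; apply/eqP; ring.
by rewrite E; apply/eqP; ring.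
Qed.

(** For a connected graph this is the span of the distance matrices; distance-regularity says that
    their products with [A] stay in it. *)
Definition class_mx (M : 'M[R]_#|T|) := forall i u v u' v',
  at_dist e i u v -> at_dist e i u' v' -> entry M u v = entry M u' v'.

Lemma class_mxD M N : class_mx M -> class_mx N -> class_mx (M + N).
Proof.
by move=> cM cN i u v u' v' uv uv'; rewrite !entryD (cM i u v u' v') // (cN i u v u' v').
Qed.

Lemma class_mxZ x M : class_mx M -> class_mx (x *: M).
Proof. by move=> cM i u v u' v' uv uv'; rewrite !entryZ (cM i u v u' v'). Qed.

Lemma class_mxB M N : class_mx M -> class_mx N -> class_mx (M - N).
Proof. by rewrite -scaleN1r => cM cN; apply: class_mxD => //; apply: class_mxZ. Qed.

Lemma class_mx_dist j : class_mx (adjmx R (at_dist e j)).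
Proof.
move=> i u v u' v' uv uv'; rewrite !entry_adj; congr (nat_of_bool _)%:R.
by apply/idP/idP => [/(at_dist_uniq uv)|/(at_dist_uniq uv')] <-.
Qed.

Lemma adj_dist0 : adjmx R (at_dist e 0) = 1%:M.
Proof. by apply/entryP => u v; rewrite !entryE at_dist0. Qed.

Lemma adj_dist1 : adjmx R (at_dist e 1) = A.
Proof. by apply/entryP => u v; rewrite !entryE at_dist1. Qed.

(** [J] is a multiple of [ev cubic], on which [A] acts as [theta 0]. *)
Lemma mulJA : J *m A = theta 0%N *: J.
Proof.
have [y y0 Y] := eval_cubic; apply: (scalerI y0).
rewrite scalemxAl -Y [RHS]scalerA mulrC -scalerA -Y; apply/eqP.
rewrite -subr_eq0 -mul_mx_scalar -mulmxBr.
have := eval_annihilator; rewrite big_ltn // mulrC rmorphM rmorphB /= evalmxX evalmxC.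
by move=> <-.
Qed.

(** The square of [A] is in the span of the distance matrices by [quadA2], its cube by the Hoffman
    polynomial; so are [A2 *m A] and, through [J], [A3 *m A]. *)
Lemma quad_distance_regular : distance_regular e.
Proof.
split=> // i j u v u' v' uv uv'.
have c1 : class_mx 1%:M by rewrite -adj_dist0; apply: class_mx_dist.
have cA : class_mx A by rewrite -adj_dist1; apply: class_mx_dist.
have cJ : class_mx J by move=> *; rewrite !entry_const.
have cI x : class_mx x%:M by rewrite -scalemx1; apply: class_mxZ.
have A2E : A2 = c^-1 *: (A *m A - a *: A - b%:M).
  by rewrite -ev_quad quadA2 scalerA mulVf // scale1r.
have cAA : class_mx (A *m A).
  have -> : A *m A = c *: A2 + b%:M + a *: A by rewrite -quadA2 ev_quad !subrK.
  by do ![apply: class_mxD | apply: class_mxZ | exact: class_mx_dist].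
(* The monic [cubic] evaluates to a multiple of [J], which expresses the cube of [A] by [J] and
   lower powers. *)
have cAAA : class_mx (A *m A *m A).
  have [y _ Y] := eval_cubic.
  pose t := theta; have X3 : 'X * 'X * 'X = cubic + (t 1%N + t 2%N + t 3%N) *: ('X * 'X)
      - (t 1%N * t 2%N + t 1%N * t 3%N + t 2%N * t 3%N) *: 'X
      + (t 1%N * t 2%N * t 3%N)%:P.
    by rewrite 3?big_ltn // big_geq // -!mul_polyC !(polyCD, polyCM) -/t; ring.
  have -> : A *m A *m A = ev ('X * 'X * 'X) by rewrite !rmorphM /= evalmxX.
  rewrite X3 rmorphD rmorphB rmorphD /= !evalmxZ rmorphM /= evalmxX evalmxC Y.
  apply: class_mxD; last exact: cI.
  by apply: class_mxB; [apply: class_mxD|]; apply: class_mxZ.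
have cA2A : class_mx (A2 *m A).
  rewrite A2E -scalemxAl !mulmxBl -scalemxAl mul_scalar_mx.
  by do ![apply: class_mxB | apply: class_mxZ].
suff /(_ i u v u' v' uv uv') : class_mx (adjmx R (at_dist e j) *m A).
  rewrite !entry_adjM => /eqP; rewrite eqr_nat => /eqP.
  congr (_ = _); apply: eq_card => w; rewrite !inE andbC (e_sym w) //.
case: j {uv uv'} => [|[|[|[|j]]]].
- by rewrite adj_dist0 mul1mx.
- by rewrite adj_dist1.
- by [].
- have -> : A3 = J - (1%:M + A + A2) by rewrite -distance_sum subKr.
  rewrite mulmxBl mulJA !mulmxDl mul1mx.
  apply: class_mxB; first exact: class_mxZ.
  by apply: class_mxD => //; apply: class_mxD.
have -> : adjmx R (at_dist e j.+4) = 0; last by rewrite mul0mx -(scale0r J); apply: class_mxZ.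
apply/entryP => x y; rewrite !entryE; have [l l3 xy] := diameter_le3 x y.
by case: (boolP (at_dist e j.+4 x y)) => // /(at_dist_uniq xy) lj; rewrite lj in l3.
Qed.

(** * Valency and eigenvectors of the distance-2 graph *)

Lemma k3_row u : (k3 e u)%:R = n - 1 - theta 0%N - (quad a b).[theta 0%N] / c.
Proof.
have /(congr1 (fun M => \sum_v entry M u v)) := distance_sum.
rewrite (eq_bigr (fun v => 1 - (at_dist e 3 u v)%:R)) => [|v _]; last by rewrite !entryE.
rewrite [in RHS](eq_bigr (fun v => (v == u)%:R + (e u v)%:R + (at_dist e 2 u v)%:R)); last first.
  by move=> v _; rewrite !entryE eq_sym.
rewrite !big_split sumrN /= sumr_const !sum_rel e_reg -theta0 (quad_row u).
rewrite (_ : [set v | v == u] = [set u]) ?cards1; last by apply/setP => v; rewrite !inE.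
rewrite mulrC mulKf // => /(canRL (subrK _))->; rewrite -[_%:R in LHS]/(k3 e u)%:R.
by ring.
Qed.

Lemma mean_k3_row u : (k3 e u)%:R = kbar.
Proof.
rewrite /mean_k3 (eq_bigr _ (fun u _ => k3_row u)) sumr_const -(k3_row u).
by rewrite -[X in _ * X]mulr_natl mulKf // lt0r_neq0 // nb_vertices_gt0.
Qed.

Lemma dist2_regular :
  exists2 d, regular (at_dist e 2) d & n - kbar - theta 0%N - 1 = d%:R.
Proof.
have [x _] := vertex_exists; exists #|[set v | at_dist e 2 x v]|.
  move=> u; apply/eqP; rewrite -(eqr_nat R); apply/eqP/(mulfI c_neq0).
  by rewrite -!quad_row.
rewrite -(mean_k3_row x) k3_row (quad_row x) mulrC mulKf //; ring.
Qed.

(** Pairing an eigenvector with the all-one vector gives [theta i] and [theta 0] times the same sum,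
    which must then be zero. *)
Lemma theta_orth1 i : (1 <= i < 4)%N -> exists v : 'rV[R]_#|T|,
  [/\ v != 0, \sum_j v 0 j = 0 & v *m A = theta i *: v].
Proof.
move=> /andP[i1 i4].
have /eigenvalueP[v vA v0] : eigenvalue A (theta i).
  rewrite eigenvalue_root_char A_spec root_prod_XsubC.
  apply/flatten_mapP; exists i; first by rewrite mem_iota.
  by rewrite mem_nseq eqxx andbT; case: spec => _ _ m_gt0 _; apply: m_gt0.
exists v; split => //; have lt0i : theta i < theta 0%N.
  case: spec => _ _ _ [lt01 lt12 lt23].
  case: i i1 i4 {v vA v0} => [|[|[|[|]]]] //= _ _.
    exact: lt_trans lt12 lt01.
  exact: lt_trans (lt_trans lt23 lt12) lt01.
have /matrixP/(_ 0 0) : (v *m A) *m const_mx 1 = v *m (A *m const_mx 1) :> 'M_1.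
  by rewrite mulmxA.
rewrite vA (adjmx_const _ e_reg) -theta0 -scalemxAl -scalemxAr !mxE.
rewrite (eq_bigr (v 0)) => [|j _]; last by rewrite mxE mulr1.
move/eqP; rewrite -subr_eq0 -mulrBl mulf_eq0 subr_eq0 lt_eqF //= => /eqP//.
Qed.

Lemma quad_orth1 i : (1 <= i < 4)%N ->
  eigenvalue_orth1 A2 ((quad a b).[theta i] / c).
Proof.
move=> /theta_orth1[v [v0 v1 vA]]; exists v; split => //.
apply: (scalerI c_neq0); rewrite scalemxAr -quadA2 (mulmx_evalmx _ vA) scalerA.
by rewrite mulrC divfK.
Qed.

(** * Strong regularity of the distance-2 graph *)

Section StronglyRegular.
Variables (i1 i2 i3 : nat) (t : R).
Hypotheses (i1_int : (1 <= i1 < 4)%N) (i3_int : (1 <= i3 < 4)%N).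
Hypothesis cubicE : cubic =
  ('X - (theta i1)%:P) * ('X - (theta i2)%:P) * ('X - (theta i3)%:P).
Hypothesis aE : a = theta i1 + theta i2.
Hypothesis bE : b = t - theta i3 * (theta i1 - theta i3 + theta i2).

Local Notation D := ((theta i1 - theta i3) * (theta i3 - theta i2)).
Local Notation l1 := ((D - t) / c).
Local Notation l2 := (- (t / c)).

Let c_l1 : c * l1 = D - t. Proof. by rewrite mulrC divfK. Qed.
Let c_l2 : c * l2 = - t. Proof. by rewrite mulrN mulrC divfK. Qed.

(** [A2] takes the value [l1] at [theta i1] and [theta i2], and [l2] at [theta i3]; so the product,
    as a polynomial in [A], is a multiple of [cubic]. *)
Lemma A2_quadratic : exists z, (A2 - l1%:M) *m (A2 - l2%:M) = z *: J.
Proof.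
have [y _ Y] := eval_cubic.
have cE x : c *: (A2 - x%:M) = ev (quad a b - (c * x)%:P).
  by rewrite scalerBr -quadA2 scale_scalar_mx -(evalmxC A) -rmorphB.
(* After scaling by [c] twice, the cofactor of [cubic] is ['X - (theta i1 + theta i2 - theta i3)],
   evaluated at [theta 0] since [A] acts so on [ev cubic = y *: J]. *)
exists (c^-1 * (c^-1 * ((theta 0%N - (theta i1 + theta i2 - theta i3)) * y))).
have cK (M : 'M[R]_#|T|) : c *: (c^-1 *: M) = M by rewrite scalerA mulfV // scale1r.
rewrite -!scalerA -Y; do 2!apply: (scalerI c_neq0); rewrite !cK.
rewrite scalemxAl scalemxAr !cE c_l1 c_l2 -[_ *m _]/(_ * _) -rmorphM /=.
have -> : (quad a b - (D - t)%:P) * (quad a b - (- t)%:P) =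
    ('X - (theta 0%N)%:P) * cubic
    + (theta 0%N - (theta i1 + theta i2 - theta i3)) *: cubic.
  rewrite cubicE /quad aE bE -!mul_polyC !(polyCD, polyCN, polyCM); ring.
rewrite [LHS]rmorphD /= evalmxZ.
have := eval_annihilator; rewrite big_ltn // => ->.
by rewrite add0r.
Qed.

(** On vectors orthogonal to the all-one vector [J] vanishes, so [x] is a root of the quadratic;
    conversely, eigenvectors for [theta i1] and [theta i3] realize both roots. *)
Lemma quad_dist2_eigenvalues x : eigenvalue_orth1 A2 x <-> x = l1 \/ x = l2.
Proof.
split=> [[v [v0 v1 vA]]|[]->].
- have [z A2z] := A2_quadratic.
  have vB l : v *m (A2 - l%:M) = (x - l) *: v.
    by rewrite mulmxBr vA mul_mx_scalar scalerBl.
  have : v *m (A2 - l1%:M) *m (A2 - l2%:M) = 0.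
    rewrite -mulmxA A2z -scalemxAr; apply/matrixP => i j; rewrite !mxE.
    rewrite (eq_bigr (v i)) => [|q _]; last by rewrite mxE mulr1.
    by rewrite ord1 v1 mulr0.
  rewrite vB -scalemxAl vB scalerA => /eqP; rewrite scaler_eq0 (negPf v0) orbF.
  by rewrite mulf_eq0 !subr_eq0 => /orP[]/eqP; [left|right].
- rewrite (_ : D - t = (quad a b).[theta i1]); first exact: quad_orth1.
  by rewrite horner_quad aE bE; ring.
- rewrite -mulNr (_ : - t = (quad a b).[theta i3]); first exact: quad_orth1.
  by rewrite horner_quad aE bE; ring.
Qed.

Lemma quad_dist2_srg : strongly_regular (at_dist e 2).
Proof.
have [z A2z] := A2_quadratic.
(* Off the diagonal, [A2_quadratic] gives the entries of [A2 *m A2] in terms of [A2] alone. *)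
have count u v : u != v -> #|[set w | at_dist e 2 u w & at_dist e 2 v w]|%:R =
    z + (l1 + l2) * (at_dist e 2 u v)%:R.
  move=> uv; rewrite -[z]mulr1 -(entry_const 1 u v) -entryZ -A2z.
  rewrite mulmxBl !mulmxBr -scalar_mxM mul_scalar_mx mul_mx_scalar.
  rewrite !entryE (negPf uv) mulr0n entry_adjM.
  rewrite (_ : [set w | _ & at_dist e 2 w v] = [set w | at_dist e 2 u w & at_dist e 2 v w]).
    by ring.
  by apply/setP => w; rewrite !inE (dist2_sym w).
have nat_eq (i j : nat) : i%:R = j%:R :> R -> i = j.
  by move/eqP; rewrite eqr_nat => /eqP.
(* A pair at distance 2 and the first edge of a path between them provide an adjacent and a
   nonadjacent pair of the distance-2 graph. *)
have [u0 [v0 uv0]] := exists_dist2.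
have [uv0' _ /existsP[w /andP[u0w _]]] : [/\ u0 != v0, ~~ e u0 v0 & [exists w, e u0 w && e w v0]].
  by apply/and3P; rewrite -dist2E.
have u0w' : u0 != w by apply: contraTneq u0w => ->; rewrite e_irr.
have n2w : ~~ at_dist e 2 u0 w by rewrite dist2E u0w andbF.
split; last first.
- exists #|[set w | at_dist e 2 u0 w & at_dist e 2 v0 w]|,
         #|[set x | at_dist e 2 u0 x & at_dist e 2 w x]| => u v uv.
  case: ifP => uv2; apply: nat_eq; rewrite !count // uv2; first by rewrite uv0.
  by rewrite (negPf n2w).
- by exists u0, v0.
- by exists u0, w.
- by have [d d_reg _] := dist2_regular; exists d.
Qed.

End StronglyRegular.
End QuadraticDist2.

(* [c] is the number of common neighbours of any two vertices at distance 2. *)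
Lemma quad_coef_gt0 (a b c : R) : c != 0 -> ev (quad a b) = c *: A2 -> 0 < c.
Proof.
move=> c0 Q; have [u [v uv]] := exists_dist2 c0 Q; rewrite lt_def c0.
have /(congr1 (fun M => entry M u v)) := Q.
rewrite ev_quad !entryE uv; move: (uv); rewrite dist2E => /and3P[/negPf-> /negPf-> _].
by rewrite entry_adjM mulr0n mulr0 !subr0 mulr1 => <-; rewrite ler0n.
Qed.

(* Since [A], [A2] and [A A2] have zero trace, [A2] cannot have a common eigenvalue on the
   eigenspaces of theta 2 and theta 3 when [theta 1 > 0]. *)
Lemma quad_coef_neq23 (a b c : R) :
  c != 0 -> ev (quad a b) = c *: A2 -> 0 <= a -> a <> theta 2%N + theta 3%N.
Proof.
move=> c0 Q a_ge0 aE; have c_gt0 := quad_coef_gt0 c0 Q.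
have [x _] := vertex_exists.
have : 0 <= (quad a b).[theta 0%N] by rewrite (quad_row Q x) mulr_ge0 ?ler0n ?ltW.
have := wsum_Xquad Q; have := wsum_quad Q; have := trA.
case: spec => _ m0 m_gt0 [lt01 lt12 lt23].
rewrite !sum4 !hornerM !hornerX m0.
have m1 : 0 < (m 1%N)%:R :> R by rewrite ltr0n m_gt0.
have m2 : 0 < (m 2%N)%:R :> R by rewrite ltr0n m_gt0.
have m3 : 0 < (m 3%N)%:R :> R by rewrite ltr0n m_gt0.
have Q23 : (quad a b).[theta 2%N] = (quad a b).[theta 3%N].
  by rewrite !horner_quad aE; ring.
have Q12 : (quad a b).[theta 2%N] < (quad a b).[theta 1%N].
  rewrite -subr_gt0 !horner_quad aE.
  rewrite (_ : _ - _ = (theta 1%N - theta 2%N) * (theta 1%N - theta 3%N)); last by ring.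
  by rewrite mulr_gt0 // subr_gt0 // (lt_trans lt23).
have th1 : 0 < theta 1%N by lra.
have th0 : 0 < theta 0%N by lra.
rewrite -Q23 !mul1r => trA0 trQ trAQ Q0.
exact: (@trace_contradiction _ _ _ _ _ _ _ _ _ _ _ m1 m2 m3 th0 th1 Q0 Q12 trA0 trQ trAQ).
Qed.

(** The witnesses are the intersection numbers a_1 and c_2: [A *m A] has entries [theta 0], a_1, c_2
    and 0 at distances 0, 1, 2 and beyond. That [a] is a natural number supplies the sign condition
    of [quad_coef_neq23]. *)
Lemma distance_regular_quad : distance_regular e ->
  exists a c : nat, c%:R != 0 :> R /\ ev (quad a%:R (theta 0%N)) = c%:R *: A2.
Proof.
move=> [_ dr].
have common i u v u' v' : at_dist e i u v -> at_dist e i u' v' ->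
    #|[set w | e u w & e w v]| = #|[set w | e u' w & e w v']|.
  move=> uv uv'; have := dr i 1%N u v u' v' uv uv'.
  by congr (_ = _); apply: eq_card => w; rewrite !inE at_dist1 // andbC (e_sym w).
have [a aP] : exists a, forall u v, e u v -> #|[set w | e u w & e w v]| = a.
  case: (pickP (fun x : T * T => e x.1 x.2)) => [[u v] /= uv|no_e].
    exists #|[set w | e u w & e w v]| => u' v' uv'.
    by apply: (common 1%N); rewrite at_dist1.
  by exists 0%N => u v uv; have := no_e (u, v); rewrite /= uv.
have [c [c0 cP]] : exists c, c != 0%N /\
    forall u v, at_dist e 2 u v -> #|[set w | e u w & e w v]| = c.
  case: (pickP (fun x : T * T => at_dist e 2 x.1 x.2)) => [[u v] /= uv|no_d].
    exists #|[set w | e u w & e w v]|; split=> [|u' v' uv']; last exact: common uv' uv.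
    rewrite cards_eq0; apply/set0Pn; move: uv; rewrite dist2E => /and3P[_ _ /existsP[w uwv]].
    by exists w; rewrite inE.
  (* Here A2 = 0, so that any nonzero [c] will do. *)
  by exists 1%N; split=> // u v uv; have := no_d (u, v); rewrite /= uv.
exists a, c; rewrite pnatr_eq0; split=> //; apply/entryP => u v.
rewrite ev_quad !entryE entry_adjM dist2E.
have [->|uv] := eqVneq u v.
  by rewrite -entry_adjM AA_diag e_irr mulr0 mulr1n subr0 subrr mulr0.
case euv: (e u v); first by rewrite (aP _ _ euv) mulr0n !(mulr1, subr0, mulr0) subrr.
rewrite mulr0n mulr0 !subr0 /=; case: (boolP [exists w, _]) => [d2|no_w].
  by rewrite cP ?mulr1 // dist2E uv euv.
rewrite mulr0; apply/eqP; rewrite pnatr_eq0 cards_eq0; apply/set0Pn => -[w].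
by rewrite inE => uwv; case/existsP: no_w; exists w.
Qed.

(** * Equality in the bound for [s1] and [s2] *)

Section BoundPolynomial.
Variables (i1 i2 i3 : nat) (t : R).
Local Notation g := (gamma2 #|T| theta m).
Local Notation a := (theta i1 + theta i2).
Local Notation b := (t - theta i3 * (theta i1 - theta i3 + theta i2)).
Local Notation p := (quad (a - g) (b - g)).
Local Notation bound := (n * (\sum_(1 <= i < 4) (m i)%:R * p.[theta i] ^+ 2) /
  (\sum_(0 <= i < 4) (m i)%:R * p.[theta i] ^+ 2)).

(* For [t] equal to tau_j and suitable indices, [p] is s_j - tau_j. *)
Lemma bound_eq_quad :
  kbar = bound <-> g != 0 /\ ev (quad a b) = g *: A2.
Proof.
have quadB x y z : ev (quad (x + z) (y + z)) = ev (quad x y) - z *: (1%:M + A).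
  rewrite !ev_quad -[(y + z)%:M]scalemx1 -[y%:M]scalemx1.
  move: (A *m A) A (1%:M : 'M[R]_#|T|) => M N I.
  by apply/matrixP => i j; rewrite !mxE; ring.
apply: (iff_trans (mean_k3_eq_bound (quad_neq0 _ _) _)); first by rewrite size_quad.
split=> [[c]|[g0 Q]].
  rewrite distance_sum => Q.
  have c0 : c != 0.
    have : ev p != 0 by rewrite eval_neq0 ?quad_neq0 ?size_quad.
    by apply: contraNneq => c0; rewrite Q c0 scale0r.
  (* Moving [c *: (1%:M + A)] to the left shifts both coefficients by [c]; by [gamma2_quad] this
     shift cancels [- g]. *)
  have Q2 : ev (quad (a - g + c) (b - g + c)) = c *: A2.
    by rewrite quadB Q [X in X - _]scalerDr addrAC subrr add0r.
  have gE := gamma2_quad c0 Q2.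
  by move: Q2; rewrite -{1 2 3}gE !subrK => ->; rewrite gE.
exists g; rewrite distance_sum scalerDr -Q.
by have := quadB (a - g) (b - g) g; rewrite !subrK => ->; rewrite [RHS]addrC subrK.
Qed.

End BoundPolynomial.

(** Brings [s1] (indices 1, 3, 2) and [s2] (indices 1, 2, 3), shifted by [tau], to the common form
    of [bound_eq_quad]. *)
Lemma k3_boundE i1 i2 i3 (S : {poly R}) (t := tau #|T| theta m S) :
  S = 'X^2 - (theta i1 + theta i2 - gamma2 #|T| theta m) *: 'X
    + (gamma2 #|T| theta m + theta i3 * (theta i1 - theta i3 + theta i2))%:P ->
  let p := quad (theta i1 + theta i2 - gamma2 #|T| theta m)
    (t - theta i3 * (theta i1 - theta i3 + theta i2) - gamma2 #|T| theta m) in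
  k3_bound #|T| theta m S =
  n * (\sum_(1 <= i < 4) (m i)%:R * p.[theta i] ^+ 2) /
  (\sum_(0 <= i < 4) (m i)%:R * p.[theta i] ^+ 2).
Proof.
move=> SE p; rewrite /k3_bound -/t; have hp i : S.[theta i] - t = p.[theta i].
  by rewrite horner_quad SE !hornerE /=; ring.
by congr (_ * _ / _); apply: eq_bigr => i _; rewrite hp.
Qed.

Lemma quad_dist2_values (a c x y : R) : c != 0 -> ev (quad a (theta 0%N)) = c *: A2 ->
  (forall z, eigenvalue_orth1 A2 z <-> z = x / c \/ z = y / c) ->
  forall z, z \in [:: theta 1%N; theta 2%N; theta 3%N] ->
  z ^+ 2 - a * z - theta 0%N = x \/ z ^+ 2 - a * z - theta 0%N = y.
Proof.
move=> c0 Q eigA2 z; rewrite -horner_quad => z_theta.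
have : eigenvalue_orth1 A2 ((quad a (theta 0%N)).[z] / c).
  by move: z_theta; rewrite !inE => /or3P[] /eqP->; apply: (quad_orth1 c0 Q).
by move/eigA2; case=> /(divIf c0); [left | right].
Qed.

End FourEigenvalues.

Theorem theorem8 (R : rcfType) (T : finType) (e : rel T) (k : nat)
    (theta : nat -> R) (m : nat -> nat)
    (e_sym : symmetric e) (e_irr : irreflexive e)
    (e_conn : connected e) (e_reg : regular e k)
    (theta0 : theta 0%N = k%:R)
    (spec : has_spectrum4 e theta m) :
  let n := #|T| in
  let g := gamma2 n theta m in
  let S1 := s1 n theta m in
  let S2 := s2 n theta m in
  let tau1 := tau n theta m S1 in
  let tau2 := tau n theta m S2 in
  let B1 := k3_bound n theta m S1 in
  let B2 := k3_bound n theta m S2 in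
  let kbar := mean_k3 R e in
  let l0 := n%:R - kbar - theta 0%N - 1 in
  [/\ kbar <= B1,
      kbar <= B2,
      (kbar = B1 \/ kbar = B2) <->
        (distance_regular e /\
         (strongly_regular_with_eigenvalues (dist2_graph e) l0
            (((theta 1%N - theta 2%N) * (theta 2%N - theta 3%N) - tau1) / g)
            (- (tau1 / g)) \/
          strongly_regular_with_eigenvalues (dist2_graph e) l0
            (- (tau2 / g))
            (((theta 1%N - theta 3%N) * (theta 3%N - theta 2%N) - tau2) / g)))
    & (kbar = B1 \/ kbar = B2) -> forall u : T, (k3 e u)%:R = kbar].
Proof.
move=> n g S1 S2 tau1 tau2 B1 B2 kbar l0.
have B1E := @k3_boundE R T theta m 1 3 2 S1 erefl.
have B2E := @k3_boundE R T theta m 1 2 3 S2 erefl.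
have eq1 := bound_eq_quad e_sym e_irr e_conn e_reg theta0 spec 1 3 2 tau1.
have eq2 := bound_eq_quad e_sym e_irr e_conn e_reg theta0 spec 1 2 3 tau2.
rewrite -B1E -/B1 in eq1; rewrite -B2E -/B2 in eq2.
have [_ _ _ [_ lt21 lt32]] := spec.
have k3_const : kbar = B1 \/ kbar = B2 -> forall u : T, (k3 e u)%:R = kbar.
  by case=> [/eq1|/eq2] [g0 Q] u; apply: (mean_k3_row e_sym e_irr e_conn e_reg theta0 spec g0 Q).
split=> //.
- by rewrite /B1 B1E; apply: mean_k3_le_bound; rewrite ?quad_neq0 ?size_quad.
- by rewrite /B2 B2E; apply: mean_k3_le_bound; rewrite ?quad_neq0 ?size_quad.
have cubic12 : \prod_(1 <= i < 4) ('X - (theta i)%:P) =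
    ('X - (theta 1%N)%:P) * ('X - (theta 2%N)%:P) * ('X - (theta 3%N)%:P).
  by rewrite 3?big_ltn // big_geq // mulr1 mulrA.
have cubic13 := cubic12; rewrite mulrAC in cubic13.
split=> [[/eq1|/eq2] [g0 Q]|[dr srg]].
- have g_gt0 : 0 < g by apply: (quad_coef_gt0 e_sym e_reg theta0 spec g0 Q).
  split; first by apply: (quad_distance_regular e_sym e_irr e_conn e_reg theta0 spec g0 Q).
  left; split.
  + by apply: (quad_dist2_srg e_sym e_irr e_conn e_reg theta0 spec g0 Q cubic13).
  + by apply: (dist2_regular e_sym e_irr e_conn e_reg theta0 spec g0 Q).
  + by rewrite -[ltLHS]mulNr ltr_pM2r ?invr_gt0 // -[ltLHS]add0r ltrD2r mulr_gt0 // subr_gt0.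
  + by apply: (quad_dist2_eigenvalues e_sym e_conn e_reg theta0 spec g0 Q _ _ cubic13).
- have g_gt0 : 0 < g by apply: (quad_coef_gt0 e_sym e_reg theta0 spec g0 Q).
  split; first by apply: (quad_distance_regular e_sym e_irr e_conn e_reg theta0 spec g0 Q).
  right; split.
  + by apply: (quad_dist2_srg e_sym e_irr e_conn e_reg theta0 spec g0 Q cubic12).
  + by apply: (dist2_regular e_sym e_irr e_conn e_reg theta0 spec g0 Q).
  (* Here the product of differences is negative, so [theta 3] carries the larger eigenvalue and the
     two eigenvalues change places. *)
  + rewrite -[ltRHS]mulNr ltr_pM2r ?invr_gt0 // -[ltRHS]add0r ltrD2r pmulr_rlt0 ?subr_lt0 //.
    by rewrite subr_gt0 (lt_trans lt32).
  + move=> x; rewrite or_comm.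
    by apply: (quad_dist2_eigenvalues e_sym e_conn e_reg theta0 spec g0 Q _ _ cubic12).
have [a [c [c0 Q]]] := distance_regular_quad e_sym e_irr e_reg theta0 dr.
have gE : g = c%:R by apply: (gamma2_quad e_sym e_irr e_reg theta0 spec c0 Q).
have a23 : a%:R <> theta 2%N + theta 3%N.
  by apply: (quad_coef_neq23 e_sym e_irr e_reg theta0 spec c0 Q); rewrite ler0n.
rewrite -gE in c0 Q.
case: srg => -[_ _ _ eigA2].
- left; apply/eq1; split=> //.
  (* The two eigenvalues of [A2] force [a] and [theta 0] to be the coefficients in [eq1], so that
     [Q] is the required identity. *)
  have [z|<- <- //] := quad_two_values13 (b := theta 0%N) (t := tau1) lt21 lt32 a23.
  by apply: (quad_dist2_values e_reg theta0 spec c0 Q) => x; rewrite mulNr.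
- right; apply/eq2; split=> //.
  have [z|<- <- //] := quad_two_values12 (b := theta 0%N) (t := tau2) lt21 lt32 a23.
  apply: (quad_dist2_values e_reg theta0 spec c0 Q) => x; rewrite mulNr or_comm.
  exact: eigA2.
Qed.
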